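(* There is a polynomial-time $2$-approximation algorithm for (the optimization version of) \textsc{Hedge Cluster Deletion} on bi-hedge graphs.
   Context: A hedge graph is a simple graph (the underlying graph) whose edge set is partitioned into classes called hedges. The optimization version of \textsc{Hedge Cluster Deletion} asks for a minimum-size set of hedges whose deletion (removing all edges of these hedges) leaves a graph in which every connected component is a clique. A bi-hedge graph is a hedge graph in which the three edges of every triangle of the underlying graph belong to at most two distinct hedges. *)

(* Defs.v *)
From mathcomp Require Import all_boot.

Set Implicit Arguments.
Unset Strict Implicit.
Unset Printing Implicit Defensive.

Definition edge_set (V : finType) (e : rel V) : {set {set V}} :=
  [set [set p.1; p.2] | p : V * V & e p.1 p.2].

Record hedge_graph := HedgeGraph {
  nverts : nat;
  adj : rel 'I_nverts;
  adj_sym : symmetric adj;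
  adj_irr : irreflexive adj;
  hedges : {set {set {set 'I_nverts}}};
  hedgesP : partition hedges (edge_set adj)
}.

Definition hedge_of (G : hedge_graph) (u v : 'I_(nverts G)) :
    {set {set 'I_(nverts G)}} :=
  pblock (hedges G) [set u; v].

Definition bi_hedge (G : hedge_graph) : Prop :=
  forall u v w : 'I_(nverts G), adj u v -> adj v w -> adj u w ->
    #|[set hedge_of u v; hedge_of v w; hedge_of u w]| <= 2.

Definition clique (V : finType) (e : rel V) (A : {set V}) : Prop :=
  {in A &, forall u v, u != v -> e u v}.

Definition cluster_graph (V : finType) (e : rel V) : Prop :=
  forall x, clique e [set y | connect e x y].

Definition delete_hedges (G : hedge_graph)
    (F : {set {set {set 'I_(nverts G)}}}) : rel 'I_(nverts G) :=
  [rel u v | adj u v && ([set u; v] \notin cover F)].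

Definition hcd_solution (G : hedge_graph)
    (F : {set {set {set 'I_(nverts G)}}}) : Prop :=
  F \subset hedges G /\ cluster_graph (delete_hedges F).

Definition hcd_approx_solution (rho : nat) (G : hedge_graph)
    (F : {set {set {set 'I_(nverts G)}}}) : Prop :=
  hcd_solution F /\
  forall F' : {set {set {set 'I_(nverts G)}}},
    hcd_solution F' -> #|F| <= rho * #|F'|.

(* A random-access machine with structured control flow. A state consists of
   registers (directly addressed by the program) and a memory (addressed
   indirectly, through registers); all cells hold natural numbers. Every
   instruction and every test of a guard has cost 1. As the only arithmetic
   operations are addition and truncated subtraction, values have at most
   linearly many bits in the running time and the size of the input, so that
   this cost is polynomially related to Turing machine time (Cook and
   Reckhow, Time bounded random access machines, 1973). *)

Inductive prog :=
  | Skip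
  | Const (r c : nat)            (* r := c *)
  | Add (r a b : nat)            (* r := a + b *)
  | Sub (r a b : nat)            (* r := a - b, truncated at 0 *)
  | Read (r a : nat)             (* r := M[a] *)
  | Write (a r : nat)            (* M[a] := r *)
  | Seq (p q : prog)
  | If (r : nat) (p q : prog)    (* runs p when r is nonzero, q otherwise *)
  | While (r : nat) (p : prog).  (* runs p as long as r is nonzero *)

Record state := State { reg : nat -> nat; mem : nat -> nat }.

Definition upd (f : nat -> nat) (i x : nat) : nat -> nat :=
  fun j => if j == i then x else f j.

Definition set_reg (s : state) (r x : nat) : state :=
  State (upd (reg s) r x) (mem s).

Definition set_mem (s : state) (a x : nat) : state :=
  State (reg s) (upd (mem s) a x).

(* [exec p s t s']: started in [s], the program [p] halts in [s'], at total
   cost [t]. *)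
Inductive exec : prog -> state -> nat -> state -> Prop :=
  | ESkip s : exec Skip s 1 s
  | EConst s r c : exec (Const r c) s 1 (set_reg s r c)
  | EAdd s r a b : exec (Add r a b) s 1 (set_reg s r (reg s a + reg s b))
  | ESub s r a b : exec (Sub r a b) s 1 (set_reg s r (reg s a - reg s b))
  | ERead s r a : exec (Read r a) s 1 (set_reg s r (mem s (reg s a)))
  | EWrite s a r : exec (Write a r) s 1 (set_mem s (reg s a) (reg s r))
  | ESeq p q s s' s'' t t' :
      exec p s t s' -> exec q s' t' s'' -> exec (Seq p q) s (t + t') s''
  | EIfTrue r p q s t s' :
      reg s r != 0 -> exec p s t s' -> exec (If r p q) s t.+1 s'
  | EIfFalse r p q s t s' :
      reg s r = 0 -> exec q s t s' -> exec (If r p q) s t.+1 s'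
  | EWhileFalse r p s : reg s r = 0 -> exec (While r p) s 1 s
  | EWhileTrue r p s s' s'' t t' :
      reg s r != 0 -> exec p s t s' -> exec (While r p) s' t' s'' ->
      exec (While r p) s (t + t').+1 s''.

Lemma exec_det p s t1 s1 t2 s2 :
  exec p s t1 s1 -> exec p s t2 s2 -> t1 = t2 /\ s1 = s2.
Proof.
move=> e1; elim: e1 t2 s2 => {p s t1 s1};
  try (by move=> s r a b t2 s2 e2; inversion e2);
  try (by move=> s r a t2 s2 e2; inversion e2);
  try (by move=> s t2 s2 e2; inversion e2).
- move=> p q s s' s'' t t' _ IHp _ IHq t2 s2 e2; inversion e2; subst.
  match goal with
  | hp : exec p _ _ _, hq : exec q _ _ _ |- _ =>
    have [-> e] := IHp _ _ hp; subst; by have [-> ->] := IHq _ _ hq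
  end.
- move=> r p q s t s' nz _ IH t2 s2 e2; inversion e2; subst; last first.
    by match goal with
       | z : reg _ _ = 0, nz : is_true (reg _ _ != 0) |- _ => rewrite z in nz
       end.
  by match goal with h : exec p _ _ _ |- _ => have [-> ->] := IH _ _ h end.
- move=> r p q s t s' z _ IH t2 s2 e2; inversion e2; subst.
    by match goal with
       | z : reg _ _ = 0, nz : is_true (reg _ _ != 0) |- _ => rewrite z in nz
       end.
  by match goal with h : exec q _ _ _ |- _ => have [-> ->] := IH _ _ h end.
- move=> r p s z t2 s2 e2; inversion e2; subst => //.
  by match goal with
     | z : reg _ _ = 0, nz : is_true (reg _ _ != 0) |- _ => rewrite z in nz
     end.
- move=> r p s s' s'' t t' nz _ IHp _ IHw t2 s2 e2; inversion e2; subst.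
    by match goal with
       | z : reg _ _ = 0, nz : is_true (reg _ _ != 0) |- _ => rewrite z in nz
       end.
  match goal with
  | hp : exec p _ _ _, hw : exec (While _ _) _ _ _ |- _ =>
    have [-> e] := IHp _ _ hp; subst; by have [-> ->] := IHw _ _ hw
  end.
Qed.

(* A list is passed in memory as its length, in cell 0, followed by its
   items; all other cells and all registers are initially 0. *)
Definition init_state (x : seq nat) : state :=
  State (fun=> 0) (fun a => nth 0 (size x :: x) a).

Definition output (s : state) : seq nat :=
  mkseq (fun i => mem s i.+1) (mem s 0).

(* The hedges of [G] are numbered by
   their positions in an arbitrary duplicate-free enumeration [hs] of
   [hedges G]. A hedge graph on n vertices is encoded by n followed by the n^2
   entries, row by row, of its adjacency matrix, in which an edge of the i-th
   hedge is marked i + 1 and a non-edge is marked 0. Entries are at most n^2,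
   so the length of this list is, up to a polynomial, the bit size of the
   instance. A set of hedges is encoded by its characteristic vector. *)

Definition hedge_mark (G : hedge_graph) (hs : seq {set {set 'I_(nverts G)}})
    (u v : 'I_(nverts G)) : nat :=
  if adj u v then (index (hedge_of u v) hs).+1 else 0.

Definition encode_graph (G : hedge_graph)
    (hs : seq {set {set 'I_(nverts G)}}) : seq nat :=
  nverts G :: [seq hedge_mark hs u v | u <- enum 'I_(nverts G),
                                      v <- enum 'I_(nverts G)].

Definition encode_hedges (n : nat) (hs : seq {set {set 'I_n}})
    (F : {set {set {set 'I_n}}}) : seq nat :=
  [seq nat_of_bool (h \in F) | h <- hs].

(* [C] is the class of hedge graphs on which the algorithm has to work; its
   behaviour on other inputs is irrelevant. *)
Definition hcd_poly_time_approx (rho : nat) (C : hedge_graph -> Prop)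
    (p : prog) : Prop :=
  exists c d : nat,
  forall (G : hedge_graph) (hs : seq {set {set 'I_(nverts G)}}),
    C G -> perm_eq hs (enum (hedges G)) ->
  exists (t : nat) (s : state) (F : {set {set {set 'I_(nverts G)}}}),
    [/\ exec p (init_state (encode_graph hs)) t s,
        t <= c * size (encode_graph hs) ^ d + c,
        output s = encode_hedges hs F
      & hcd_approx_solution rho F].

(* Main.v *)
(* In a bi-hedge graph, the solutions are the sets of hedges that satisfy
   clauses of two kinds. A path u, v, w with u and w non-adjacent asks for the
   hedge of uv or that of vw; a triangle with two edges in a hedge a and the
   third one in a hedge c asks that c be deleted only together with a. Call a
   hedge b implied by x if every solution containing x contains b. If a path
   asks for x or y, and b and b' are implied by x and y, then every solution
   contains b or b'. A maximal set of disjoint pairs {b, b'} of this kind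
   covers a set Z that is at most twice as large as any solution, and the
   hedges that do not imply any hedge outside Z, by means of the triangles,
   form a solution F contained in Z.

   The algorithm stores for each hedge x a witness w x, which is a hedge
   outside Z implied by x, or 0 if none has been found. As long as some path
   asks for x or y with w x and w y nonzero, it adds w x and w y to Z and
   recomputes the witnesses. *)

Require Import Defs.
From mathcomp Require Import all_boot zify.
Import Defs.

Set Implicit Arguments.
Unset Strict Implicit.
Unset Printing Implicit Defensive.

(** * Bounded loops on the random-access machine *)

Inductive cmd :=
  | CSkip
  | CConst (r c : nat)
  | CAdd (r a b : nat)
  | CSub (r a b : nat)
  | CRead (r a : nat)
  | CWrite (a r : nat)
  | CSeq (p q : cmd)
  | CIf (r : nat) (p q : cmd)
  | CFor (i b : nat) (p : cmd).

Declare Scope cmd_scope.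
Delimit Scope cmd_scope with cmd.
Bind Scope cmd_scope with cmd.
Notation "p ;; q" := (CSeq p q) (at level 61, right associativity) : cmd_scope.

(* Counting down lets the loop counter be the guard of the loop. Registers 0
   and 1 are assumed to hold the constants 0 and 1. *)
Fixpoint compile (p : cmd) : prog :=
  match p with
  | CSkip => Skip
  | CConst r c => Const r c
  | CAdd r a b => Add r a b
  | CSub r a b => Sub r a b
  | CRead r a => Read r a
  | CWrite a r => Write a r
  | CSeq p q => Seq (compile p) (compile q)
  | CIf r p q => If r (compile p) (compile q)
  | CFor i b p => Seq (Add i b 0) (While i (Seq (Sub i i 1) (compile p)))
  end.

Fixpoint count_down (f : state -> state) (i k : nat) (s : state) : state :=
  if k is k'.+1 then count_down f i k' (f (set_reg s i k')) else s.

Fixpoint den (p : cmd) (s : state) : state :=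
  match p with
  | CSkip => s
  | CConst r c => set_reg s r c
  | CAdd r a b => set_reg s r (reg s a + reg s b)
  | CSub r a b => set_reg s r (reg s a - reg s b)
  | CRead r a => set_reg s r (mem s (reg s a))
  | CWrite a r => set_mem s (reg s a) (reg s r)
  | CSeq p q => den q (den p s)
  | CIf r p q => if reg s r != 0 then den p s else den q s
  | CFor i b p => count_down (den p) i (reg s b) (set_reg s i (reg s b))
  end.

Fixpoint writes (p : cmd) : seq nat :=
  match p with
  | CSkip | CWrite _ _ => [::]
  | CConst r _ | CAdd r _ _ | CSub r _ _ | CRead r _ => [:: r]
  | CSeq p q | CIf _ p q => writes p ++ writes q
  | CFor i _ p => i :: writes p
  end.

Fixpoint no_store (p : cmd) : bool :=
  match p with
  | CWrite _ _ => false
  | CSeq p q | CIf _ p q => no_store p && no_store q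
  | CFor _ _ p => no_store p
  | _ => true
  end.

(* Loop bounds may only be taken from registers 2 and 3, which are never
   written, so that the running time can be read off the syntax. *)
Fixpoint bounded_loops (p : cmd) : bool :=
  match p with
  | CSeq p q | CIf _ p q => bounded_loops p && bounded_loops q
  | CFor i b p => [&& b \in [:: 2; 3], i \notin writes p & bounded_loops p]
  | _ => true
  end.

Fixpoint cost_deg (p : cmd) : nat :=
  match p with
  | CSeq p q | CIf _ p q => maxn (cost_deg p) (cost_deg q)
  | CFor _ _ p => (cost_deg p).+1
  | _ => 0
  end.

(** In a loop, the extra 4 pays 2 per iteration, for the guard test and the decrement, and 2 once,
    for the initialisation and the final test. *)
Fixpoint cost_coef (p : cmd) : nat :=
  match p with
  | CSeq p q => cost_coef p + cost_coef q
  | CIf _ p q => (cost_coef p + cost_coef q).+1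
  | CFor _ _ p => (cost_coef p).+4
  | _ => 1
  end.

(** * Frame properties and running time of commands *)

Lemma den_frame p s r : r \notin writes p -> reg (den p s) r = reg s r.
Proof.
elim: p s => [|r' c|r' a b|r' a b|r' a|a r'|p IHp q IHq|r' p IHp q IHq|i b p IHp] s //=;
  rewrite ?inE ?mem_cat ?negb_or.
1-4: by rewrite /upd => /negPf ->.
- by case/andP=> np nq; rewrite IHq ?IHp.
- by case/andP=> np nq; case: ifP; rewrite ?IHq ?IHp.
case/andP=> /negPf ni np.
have: reg (set_reg s i (reg s b)) r = reg s r by rewrite /= /upd ni.
elim: (reg s b) (set_reg _ _ _) => [|k IHk] s' //= e.
by apply: IHk; rewrite IHp //= /upd ni.
Qed.

Lemma den_no_store p s : no_store p -> mem (den p s) = mem s.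
Proof.
elim: p s => [|r' c|r' a b|r' a b|r' a|a r'|p IHp q IHq|r' p IHp q IHq|i b p IHp] s //=.
- by case/andP=> np nq; rewrite IHq ?IHp.
- by case/andP=> np nq; case: ifP; rewrite ?IHq ?IHp.
move=> np; have: mem (set_reg s i (reg s b)) = mem s by [].
elim: (reg s b) (set_reg _ _ _) => [|k IHk] s' //= e.
by apply: IHk; rewrite IHp.
Qed.

(** As only registers above 3 are written, the constants and the loop bounds persist through every
    subcommand, and each level of loop nesting contributes one factor [B]. *)
Lemma exec_den B p s :
    all (ltn 3) (writes p) -> bounded_loops p ->
    reg s 0 = 0 -> reg s 1 = 1 -> reg s 2 <= B -> reg s 3 <= B -> 0 < B ->
  exists t, exec (compile p) s t (den p s) /\ t <= cost_coef p * B ^ cost_deg p.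
Proof.
move=> + + + + + + B0.
have le_pow d e : d <= e -> B ^ d <= B ^ e by move=> ?; rewrite leq_pexp2l.
elim: p s => [|r' c|r' a b|r' a b|r' a|a r'|p IHp q IHq|r' p IHp q IHq|i b p IHp] s.
1-6: by move=> *; exists 1; split=> //; constructor.
all: rewrite /= ?all_cat.
- case/andP=> wp wq /andP [bp bq] s0 s1 s2 s3.
  have [t [et lt]] := IHp s wp bp s0 s1 s2 s3.
  have fr r : r <= 3 -> reg (den p s) r = reg s r.
    move=> r3; apply: den_frame; apply/negP => /(allP wp) /=; lia.
  have [||||t' [et' lt']] := IHq (den p s) wq bq; rewrite ?fr //.
  exists (t + t'); split; first by econstructor; eauto.
  rewrite mulnDl; apply: leq_add; [apply: leq_trans lt _|apply: leq_trans lt' _];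
  by rewrite leq_mul2l le_pow ?orbT // ?leq_maxl ?leq_maxr.
- case/andP=> wp wq /andP [bp bq] s0 s1 s2 s3.
  have M1 : 0 < B ^ maxn (cost_deg p) (cost_deg q) by rewrite expn_gt0 B0.
  have [t [et lt]] := IHp s wp bp s0 s1 s2 s3.
  have [t' [et' lt']] := IHq s wq bq s0 s1 s2 s3.
  have {}lt : t <= cost_coef p * B ^ maxn (cost_deg p) (cost_deg q).
    by apply: leq_trans lt _; rewrite leq_mul2l le_pow ?orbT // leq_maxl.
  have {}lt' : t' <= cost_coef q * B ^ maxn (cost_deg p) (cost_deg q).
    by apply: leq_trans lt' _; rewrite leq_mul2l le_pow ?orbT // leq_maxr.
  case: ifP => [nz|/negbFE/eqP z].
    exists t.+1; split; first by constructor.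
    rewrite mulSn mulnDl; lia.
  exists t'.+1; split; first by apply: EIfFalse.
  rewrite mulSn mulnDl; lia.
case/andP=> i3 wp /and3P [b23 ip bp] s0 s1 s2 s3.
have bB : reg s b <= B by move: b23; rewrite !inE => /orP [] /eqP ->.
set C := cost_coef p * B ^ cost_deg p in IHp *.
have loop k s' : (forall r, r <= 3 -> reg s' r = reg s r) -> reg s' i = k ->
    exists t, exec (While i (Seq (Sub i i 1) (compile p))) s' t
                (count_down (den p) i k s') /\ t <= (C + 2) * k + 1.
  elim: k s' => [|k IHk] s' fr ik.
    by exists 1; split; [apply: EWhileFalse|lia].
  have eqi : set_reg s' i k = set_reg s' i (reg s' i - reg s' 1).
    by rewrite ik fr // s1 subn1.
  have fr' r : r <= 3 -> reg (set_reg s' i k) r = reg s r.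
    by move=> r3; rewrite /= /upd; case: eqP => [|_]; [lia|apply: fr].
  have [||||t [et lt]] := IHp (set_reg s' i k) wp bp; rewrite ?fr' //.
  have [r r3||t' [et' lt']] := IHk (den p (set_reg s' i k)).
  - by rewrite den_frame ?fr' //; apply/negP => /(allP wp) /=; lia.
  - by rewrite den_frame //= /upd eqxx.
  exists (1 + t + t').+1; split; last by rewrite mulnS; lia.
  apply: EWhileTrue et'; first by rewrite ik.
  by apply: ESeq et; rewrite eqi; constructor.
have [r r3||t [et lt]] := loop (reg s b) (set_reg s i (reg s b)).
- by rewrite /= /upd; case: eqP => // ?; lia.
- by rewrite /= /upd eqxx.
exists (1 + t); split.
  apply: ESeq et; have e : reg s b = reg s b + reg s 0 by rewrite s0 addn0.
  by rewrite [X in set_reg _ _ X]e; constructor.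
have M1 : 0 < B ^ (cost_deg p).+1 by rewrite expn_gt0 B0.
have M2 : B <= B ^ (cost_deg p).+1 by rewrite -{1}(expn1 B) le_pow.
have M3 : (C + 2) * reg s b <= (C + 2) * B by rewrite leq_mul2l bB orbT.
have M4 : C * B = cost_coef p * B ^ (cost_deg p).+1.
  by rewrite /C expnSr mulnA.
rewrite -[(cost_coef p).+4]addn4 mulnDl -M4; move: M3; rewrite mulnDl; lia.
Qed.

(** The counter descends, so [P k] describes the state once the iterations with counter at least [k]
    are done. Stability of [P] under writes to [i] absorbs the initialisation and the decrements. *)
Lemma for_ind (P : nat -> state -> Prop) i b p s :
    i \notin writes p ->
    (forall k s' x, P k s' -> P k (set_reg s' i x)) ->
    (forall k s', k < reg s b -> reg s' i = k -> P k.+1 s' -> P k (den p s')) ->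
  P (reg s b) s -> P 0 (den (CFor i b p) s).
Proof.
move=> ip Pi step /= /(Pi _ _ (reg s b)).
have: forall k, k <= reg s b -> forall s', P k s' ->
    P 0 (count_down (den p) i k s'); last by move/(_ _ (leqnn _)); exact.
elim=> [|k IHk] lek s' //= Pk.
apply: IHk; first exact: ltnW.
by apply: step => //=; [rewrite /upd eqxx|apply: Pi].
Qed.

(* [J X s] is meant to be an invariant of [s] that records that [X] holds, at
   least as long as nothing has been changed. *)
Lemma for_scan (J : Prop -> state -> Prop) (Q : nat -> Prop) i b p s (X : Prop) :
    i \notin writes p ->
    (forall X Y s', (X -> Y) -> J X s' -> J Y s') ->
    (forall Y s' x, J Y s' -> J Y (set_reg s' i x)) ->
    (forall k s' Y, k < reg s b -> reg s' i = k ->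
       J Y s' -> J (Y /\ Q k) (den p s')) ->
  J X s -> J (X /\ forall k, k < reg s b -> Q k) (den (CFor i b p) s).
Proof.
move=> ip Jmon Ji step JX.
pose P k s' := J (X /\ forall k', k <= k' < reg s b -> Q k') s'.
apply: (Jmon (X /\ forall k', 0 <= k' < reg s b -> Q k')) => //.
apply: (@for_ind P) => //.
- by move=> k s' x; apply: Ji.
- move=> k s' kb ik Pk; apply: Jmon (step _ _ _ kb ik Pk).
  move=> [[HX Hk] Qk]; split=> // k' /andP [].
  rewrite leq_eqVlt => /orP [/eqP <- //|kk' k'b]; apply: Hk; exact/andP.
by apply: Jmon JX => HX; split=> // k' /andP [] ? ?; lia.
Qed.

(** * The algorithm *)

Local Notation r0 := 0 (only parsing).
Local Notation r1 := 1 (only parsing).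
Local Notation rN := 2 (only parsing).
Local Notation rL := 3 (only parsing).
Local Notation rU := 4 (only parsing).
Local Notation rV := 5 (only parsing).
Local Notation rW := 6 (only parsing).
Local Notation rJ := 7 (only parsing).
Local Notation rA := 8 (only parsing).
Local Notation rB := 9 (only parsing).
Local Notation rC := 10 (only parsing).
Local Notation rT := 11 (only parsing).
Local Notation rY := 12 (only parsing).
Local Notation rFlag := 13 (only parsing).
Local Notation rK := 14 (only parsing).
Local Notation rI := 15 (only parsing).
Local Notation rX := 16 (only parsing).
Local Notation rM := 17 (only parsing).
Local Notation rLL := 18 (only parsing).

(* The entry (u, v) of the matrix is in cell 2 + u * n + v; the product is
   computed by adding n once for each j < u. *)
Definition get_mark (d u v : nat) : cmd := (
  CAdd rT v r1 ;; CAdd rT rT r1 ;;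
  CFor rJ rN (CSub rY u rJ ;; CIf rY (CAdd rT rT rN) CSkip) ;;
  CRead d rT)%cmd.

Definition triples (body : cmd) : cmd :=
  CFor rU rN (CFor rV rN (CFor rW rN (
    get_mark rA rU rV ;; get_mark rB rV rW ;; get_mark rC rU rW ;;
    body)))%cmd.

(** The number of hedges is not given in the input. As every hedge has an edge, it is the largest
    mark in the matrix. *)
Definition max_mark : cmd :=
  CFor rU rN (CFor rV rN (
    get_mark rA rU rV ;; CSub rT rA rM ;; CIf rT (CAdd rM rA r0) CSkip))%cmd.

(* With L the length of the input, the matching Z is kept in the cells L + x
   and the witnesses w in the cells 2 * L + x, for each mark x > 0. *)
Definition reset : cmd :=
  CFor rX rL (
    CAdd rT rX rL ;; CRead rT rT ;;
    CIf rT (CConst rY 0) (CAdd rY rX r0) ;;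
    CAdd rT rX rLL ;; CWrite rT rY)%cmd.

(** Truncated differences in both directions add up to the distance of two marks, which turns
    equality into a zero test. The witness of a hedge containing uv and vw is passed on to the hedge
    of uw. *)
Definition relax : cmd := (
  CSub rT rA rB ;; CSub rY rB rA ;; CAdd rT rT rY ;;
  CIf rT CSkip (CIf rA (CIf rC (
    CAdd rY rC rLL ;; CRead rT rY ;;
    CIf rT CSkip (CAdd rX rA rLL ;; CRead rT rX ;; CWrite rY rT))
    CSkip) CSkip))%cmd.

(** Both cells are tested before either is written, so two equal witnesses are accepted as well;
    they add one element to Z instead of two. *)
Definition match_pair : cmd :=
  CIf rT (CIf rY (
    CAdd rT rT rL ;; CRead rX rT ;;
    CIf rX CSkip (
      CAdd rY rY rL ;; CRead rX rY ;;
      CIf rX CSkip (CWrite rT r1 ;; CWrite rY r1 ;; CConst rFlag 1)))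
    CSkip) CSkip.

Definition match_witnesses : cmd := (
  CSub rT rU rW ;; CSub rY rW rU ;; CAdd rT rT rY ;;
  CIf rT (CIf rA (CIf rB (CIf rC CSkip (
    CAdd rT rA rLL ;; CRead rT rT ;; CAdd rY rB rLL ;; CRead rY rY ;;
    match_pair)) CSkip) CSkip) CSkip)%cmd.

Definition round : cmd :=
  (CConst rFlag 0 ;; reset ;; CFor rI rL (triples relax) ;;
   triples match_witnesses)%cmd.

(** Only cells below L are overwritten, while the witnesses start at 2 * L and can still be read.
    Cell 0 receives the output length last. *)
Definition write_output : cmd :=
  (CFor rX rL (
     CAdd rT rX rLL ;; CRead rT rT ;;
     CIf rT (CConst rY 0) (CConst rY 1) ;; CWrite rX rY) ;;
   CWrite r0 rM)%cmd.

Definition main : cmd :=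
  (max_mark ;; CConst rFlag 1 ;; CFor rK rL (CIf rFlag round CSkip) ;;
   write_output)%cmd.

Lemma den_seq p q s : den (p ;; q) s = den q (den p s).
Proof. by []. Qed.

Lemma den_if r p q s :
  den (CIf r p q) s = if reg s r != 0 then den p s else den q s.
Proof. by []. Qed.

(** * Correctness of the algorithm *)

Section Correctness.

Variables (n m L : nat) (mk : nat -> nat -> nat).
Hypothesis L_def : L = (n * n).+1.
Hypothesis m_lt : m < L.
Hypothesis mk_le : forall u v, u < n -> v < n -> mk u v <= m.
Hypothesis mk_max :
  0 < m -> exists u v, [/\ u < n, v < n & mk u v = m].

(** * Clauses on marks, and invariants of the matching and the witnesses *)

Definition is_p3 u v w :=
  [&& mk u v != 0, mk v w != 0, mk u w == 0 & u != w].

(** In a triangle with uv and vw in one hedge and uw in another, deleting the hedge of uw alone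
    would leave the induced path u, v, w. *)
Definition is_imp u v w :=
  [&& mk u v != 0, mk u w != 0 & mk u v == mk v w].

Definition feasible (S : pred nat) :=
  forall u v w, u < n -> v < n -> w < n ->
    (is_p3 u v w -> S (mk u v) || S (mk v w)) /\
    (is_imp u v w -> S (mk u w) -> S (mk u v)).

Definition cnt (S : pred nat) := count S (iota 1 m).

Definition in_Z (f : nat -> nat) x := f (L + x) != 0.
Definition wit (f : nat -> nat) x := f (L + L + x).

Definition static s :=
  [/\ reg s r0 = 0, reg s r1 = 1, reg s rN = n, reg s rL = L
    & reg s rLL = L + L].

Definition input (f : nat -> nat) :=
  forall u v, u < n -> v < n -> f (2 + u * n + v) = mk u v.

(** This is the approximation ratio in a form that can be maintained pair by pair: every feasible
    set contains at least half of Z. *)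
Definition matched f := forall S, feasible S ->
  cnt (in_Z f) <= 2 * cnt (predI (in_Z f) S).

Definition wit_ok f := forall x, 0 < x <= m ->
  (wit f x != 0 -> [/\ 0 < wit f x <= m, ~~ in_Z f (wit f x) &
     forall S, feasible S -> S x -> S (wit f x)]) /\
  (~~ in_Z f x -> wit f x != 0).

Definition wit_closed f := forall u v w, u < n -> v < n -> w < n ->
  is_imp u v w -> wit f (mk u v) != 0 -> wit f (mk u w) != 0.

Definition wit_cover f := forall u v w, u < n -> v < n -> w < n ->
  is_p3 u v w -> wit f (mk u v) = 0 \/ wit f (mk v w) = 0.

(** The last matrix entry sits in cell L, which is also the matching cell of mark 0. Hedges are
    marked from 1 on, so the matching never overwrites an entry. *)
Lemma addr_le u v : u < n -> v < n -> 2 + u * n + v <= L.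
Proof. move=> un vn; rewrite L_def; nia. Qed.

(** * Counting marks *)

Lemma cnt_sub (P Q : pred nat) :
  (forall x, 0 < x <= m -> P x -> Q x) -> cnt P <= cnt Q.
Proof.
move=> PQ; rewrite /cnt -!size_filter; apply: uniq_leq_size.
  by rewrite filter_uniq ?iota_uniq.
move=> x; rewrite !mem_filter mem_iota add1n ltnS => /andP [Px xm].
by rewrite xm PQ.
Qed.

Lemma eq_cnt (P Q : pred nat) :
  (forall x, 0 < x <= m -> P x = Q x) -> cnt P = cnt Q.
Proof.
by move=> PQ; apply/eqP; rewrite eqn_leq !cnt_sub // => x /PQ ->.
Qed.

Lemma cnt_le P : cnt P <= m.
Proof. by rewrite -[X in _ <= X](size_iota 1) count_size. Qed.

Lemma cnt_add1 (P : pred nat) a : 0 < a <= m -> ~~ P a ->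
  cnt [predU1 a & P] = (cnt P).+1.
Proof.
move=> am Pa; have := count_predUI (pred1 a) P (iota 1 m).
rewrite count_uniq_mem ?iota_uniq // mem_iota add1n ltnS am.
rewrite (@eq_count _ (predI _ _) pred0) ?count_pred0 ?addn0.
  by rewrite add1n => <-; apply: eq_count => x.
by move=> x /=; case: eqP => //= ->; apply: negPf.
Qed.

Lemma cnt_lt (P Q : pred nat) a : 0 < a <= m -> ~~ P a -> Q a ->
  (forall x, 0 < x <= m -> P x -> Q x) -> cnt P < cnt Q.
Proof.
move=> am Pa Qa PQ; rewrite -(cnt_add1 am Pa).
by apply: cnt_sub => x xm; case/predU1P=> [-> //|]; apply: PQ.
Qed.

(** * Reading the matrix and scanning triples of vertices *)

Lemma static_den p s :
  all (fun r => r \notin writes p) [:: r0; r1; rN; rL; rLL] ->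
  static s -> static (den p s).
Proof.
by case/and5P=> ? ? ? ? /andP [? _] [? ? ? ? ?]; split; rewrite den_frame.
Qed.

Lemma get_mark_reg d u v s : static s -> input (mem s) ->
    u \notin [:: rJ; rT; rY] -> v != rT -> reg s u < n -> reg s v < n ->
  reg (den (get_mark d u v) s) d = mk (reg s u) (reg s v).
Proof.
move=> st inp; rewrite !inE !negb_or => /and3P [/negPf uJ /negPf uT /negPf uY].
move=> /negPf vT un vn; rewrite /= {1}/upd eqxx.
set s1 := set_reg (set_reg s _ _) _ _.
set p := (CSub rY u rJ ;; CIf rY (CAdd rT rT rN) CSkip)%cmd.
rewrite -[set_reg s1 rJ _]/(set_reg s1 rJ (reg s1 rN)).
rewrite -/(den (CFor rJ rN p) s1).
(* The iterations done so far are those with j in [k, n). As u is below n, the truncated difference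
   [reg s u - k] counts those with j < u. *)
pose P k s' := [/\ mem s' = mem s, reg s' rN = n, reg s' u = reg s u &
  reg s' rT = 2 + (reg s u - k) * n + reg s v].
have: P 0 (den (CFor rJ rN p) s1).
  case: (st) => _ s_1 s_N _ _.
  apply: for_ind => //.
  - move=> k s' x [? ? ? ?]; split=> //=.
    by rewrite /upd uJ.
  - move=> k s' kn s'J [m' n' u' t']; rewrite /= /upd /= s'J u'.
    case: ifP => ku; split=> //=; rewrite /upd /= ?uT ?uY //.
      rewrite t' n'; have -> : reg s u - k = (reg s u - k.+1).+1 by lia.
      lia.
    rewrite t'; lia.
  have -> : reg s1 rN = n by [].
  split=> //=; rewrite /upd /= ?uT //.
  rewrite s_1; have -> : reg s u - n = 0 by lia.
  lia.
case=> -> _ _ ->; rewrite subn0.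
by apply: inp.
Qed.

(** This lifts the effect of the body on one triple to the triple loop. [K] sees only the memory and
    the flag, which the loading of the three marks leaves alone; its first argument collects what
    the scanned triples have established. *)
Lemma triples_scan (K : Prop -> (nat -> nat) -> nat -> Prop)
    (Q : nat -> nat -> nat -> Prop) body (X : Prop) s :
    all (fun r => r \notin writes body)
      [:: r0; r1; rN; rL; rLL; rU; rV; rW] ->
    (forall X Y f e, (X -> Y) -> K X f e -> K Y f e) ->
    (forall X f e, K X f e -> input f) ->
    (forall u v w t Y, u < n -> v < n -> w < n -> static t ->
       [/\ reg t rU = u, reg t rV = v & reg t rW = w] ->
       [/\ reg t rA = mk u v, reg t rB = mk v w & reg t rC = mk u w] ->
       K Y (mem t) (reg t rFlag) ->
       K (Y /\ Q u v w) (mem (den body t)) (reg (den body t) rFlag)) ->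
  static s -> K X (mem s) (reg s rFlag) ->
  K (X /\ forall u v w, u < n -> v < n -> w < n -> Q u v w)
    (mem (den (triples body) s)) (reg (den (triples body) s) rFlag).
Proof.
move=> /and5P [b0 b1 bN bL /and5P [bLL bU bV bW _]] Kmon Kinp step st KX.
have stb t : static t -> static (den body t).
  by move=> st'; apply: static_den => //=; rewrite b0 b1 bN bL bLL.
(* In the inner scans, [c] fixes the counters of the enclosing loops. *)
pose J c Y t := [/\ K Y (mem t) (reg t rFlag), static t & c t].
have Jmon c Y Z t : (Y -> Z) -> J c Y t -> J c Z t.
  by move=> YZ [? ? ?]; split=> //; apply: Kmon YZ _.
have rNn t : static t -> reg t rN = n by case.
set b := (get_mark rA rU rV ;; get_mark rB rV rW ;;
          get_mark rC rU rW ;; body)%cmd.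
have iJ c i Y t x : i \in [:: rU; rV; rW] -> c (set_reg t i x) ->
    J c Y t -> J c Y (set_reg t i x).
  by rewrite !inE => /or3P [] /eqP -> ? [].
have [||u t Y|KQ _ _] := @for_scan (J (fun=> True)) (fun u =>
    forall v, v < n -> forall w, w < n -> Q u v w) rU rN
    (CFor rV rN (CFor rW rN b)) s X _ (Jmon _) _ _ (And3 KX st Logic.I).
- by rewrite /= !inE bU.
- by move=> Y t x; apply: iJ.
- rewrite rNn // => un tU [KY stt _].
  have [||v t' Z|KQ st' _] := @for_scan (J (fun t => reg t rU = u)) (fun v =>
    forall w, w < n -> Q u v w) rV rN (CFor rW rN b) t Y _ (Jmon _) _ _
    (And3 KY stt tU).
  - by rewrite /= !inE bV.
  - by move=> Z t' x [? ? ?]; apply: iJ.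
  - rewrite rNn // => vn t'V [KZ stt' t'U].
    have [||w t2 Z'|KQ st' [t'U' _]] := @for_scan
      (J (fun t => reg t rU = u /\ reg t rV = v)) (Q u v) rW rN b t' Z _ (Jmon _)
      _ _ (And3 KZ stt' (conj t'U t'V)).
    - by rewrite /= !inE bW.
    - by move=> Z' t2 x [? ? ?]; apply: iJ.
    - rewrite rNn // => wn t2W [KZ' st2 [t2U t2V]].
      pose a1 := den (get_mark rA rU rV) t2.
      pose a2 := den (get_mark rB rV rW) a1.
      pose a3 := den (get_mark rC rU rW) a2.
      have inp := Kinp _ _ _ KZ'.
      have st1 : static a1 by apply: static_den.
      have sta2 : static a2 by apply: static_den.
      have st3 : static a3 by apply: static_den.
      have m1 : mem a1 = mem t2 by apply: den_no_store.
      have m2 : mem a2 = mem t2 by rewrite -m1; apply: den_no_store.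
      have m3 : mem a3 = mem t2 by rewrite -m2; apply: den_no_store.
      have fr r : r \in [:: rU; rV; rW; rFlag] -> reg a3 r = reg t2 r.
        by rewrite !inE => /or4P [] /eqP ->; rewrite /a3 /a2 /a1 !den_frame.
      have aA : reg a3 rA = mk u v.
        rewrite /a3 /a2 2?(@den_frame _ _ rA) // get_mark_reg ?t2U ?t2V //.
      have aB : reg a3 rB = mk v w.
        rewrite /a3 (@den_frame _ _ rB) // get_mark_reg ?m1 //.
        + by rewrite !den_frame // t2V t2W.
        + by rewrite den_frame // t2V.
        by rewrite den_frame // t2W.
      have aC : reg a3 rC = mk u w.
        rewrite get_mark_reg ?m2 // !den_frame // ?t2U ?t2W //.
      rewrite /b 3!den_seq -/a1 -/a2 -/a3; clearbody a3.
      split; last by rewrite !den_frame // !fr.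
        by apply: step => //; rewrite ?m3 ?[reg _ rFlag]fr //; split; rewrite fr.
      exact: stb.
    split=> //; apply: Kmon KQ => -[HZ H]; split=> // w wn.
    by apply: H; rewrite rNn.
  split=> //; apply: Kmon KQ => -[HY H]; split=> // v w vn wn.
  by apply: H => //; rewrite rNn.
apply: Kmon KQ => -[HX H]; split=> // u v w un vn wn.
by apply: H => //; rewrite rNn.
Qed.

(** * Computing the witnesses *)

Lemma reset_spec s : static s ->
  [/\ static (den reset s),
      forall a, a < L + L -> mem (den reset s) a = mem s a
    & forall x, x < L ->
        wit (mem (den reset s)) x = if in_Z (mem s) x then 0 else x].
Proof.
move=> st; pose P k s' := [/\ static s',
  forall a, a < L + L -> mem s' a = mem s a &
  forall x, k <= x < L -> wit (mem s') x = if in_Z (mem s) x then 0 else x].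
suff: P 0 (den reset s) by case=> ? ? H; split=> // x xL; apply: H.
have sL : reg s rL = L by case: st.
apply: for_ind; rewrite ?sL => //; last first.
- by split=> // x; case: leqP.
- move=> k t kL tX [stt lo hi].
  case: (stt) => t0 _ _ tL tLL.
  set body := (_ ;; _)%cmd.
  have E a : mem (den body t) a =
    if a == L + L + k then (if in_Z (mem s) k then 0 else k) else mem t a.
    rewrite /= /upd /= tX tL (addnC k) lo ?ltn_add2l //.
    rewrite -/(in_Z (mem s) k); case: (in_Z (mem s) k) => /=;
    by rewrite /upd /= tLL tX ?t0 ?addn0 (addnC k).
  split; first by apply: static_den.
  - by move=> a aL; rewrite E lo //; case: eqP => // ?; lia.
  - move=> x /andP [kx xL]; rewrite /wit E eqn_add2l.
    case: eqP => [-> //|nx]; apply: hi; lia.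
Qed.

Lemma input_agree f g :
  (forall a, a < L + L -> f a = g a) -> input g -> input f.
Proof.
move=> fg inp u v un vn; rewrite fg ?inp //.
by have := addr_le un vn; lia.
Qed.

Lemma in_Z_agree f g x : (forall a, a < L + L -> f a = g a) ->
  x <= m -> in_Z f x = in_Z g x.
Proof. by move=> fg xm; rewrite /in_Z fg //; lia. Qed.

(** A hedge outside Z implies itself, so it can be its own witness. *)
Lemma wit_ok_reset f g :
  (forall a, a < L + L -> f a = g a) ->
  (forall x, x < L -> wit f x = if in_Z g x then 0 else x) -> wit_ok f.
Proof.
move=> fg fx x /andP [x0 xm].
have xL : x < L by apply: leq_ltn_trans xm m_lt.
rewrite fx // -(in_Z_agree fg) //; case: ifP => // Zx.
rewrite Zx x0 xm; split=> //; by case: x x0 {xm xL Zx}.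
Qed.

(** The condition does not ask for a nonzero witness of [mk u v]: if it is zero, a zero is written
    over a zero. *)
Lemma relax_mem u v w s : static s ->
    [/\ reg s rU = u, reg s rV = v & reg s rW = w] ->
    [/\ reg s rA = mk u v, reg s rB = mk v w & reg s rC = mk u w] ->
  forall a, mem (den relax s) a =
    if is_imp u v w && (wit (mem s) (mk u w) == 0) && (a == L + L + mk u w)
    then wit (mem s) (mk u v) else mem s a.
Proof.
move=> [_ _ _ _ sLL] [sU sV sW] [sA sB sC] a.
rewrite /is_imp /= /upd /= sA sB sC sLL.
rewrite addn_eq0 !subn_eq0 -eqn_leq.
case: (mk u v == mk v w) => /=; last by rewrite !andbF.
case: (mk u v != 0) => //=; case: (mk u w != 0) => //=.
rewrite !(addnC _ (L + L)) -!/(wit (mem s) _).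
by case: (wit (mem s) (mk u w) == 0).
Qed.

Lemma match_pair_mem s : static s ->
  let x := reg s rT in
  let y := reg s rY in
  let go := [&& x != 0, y != 0, ~~ in_Z (mem s) x & ~~ in_Z (mem s) y] in
  (forall a, mem (den match_pair s) a =
     if go && ((a == L + x) || (a == L + y)) then 1 else mem s a) /\
  reg (den match_pair s) rFlag = if go then 1 else reg s rFlag.
Proof.
move=> [s0 s1 _ sL _] x y.
rewrite /= /upd /= sL s1 -/x -/y !(addnC _ L) -!/(in_Z (mem s) _).
move: (x != 0) (y != 0) => [] [] //.
move: (in_Z (mem s) x) (in_Z (mem s) y) => [] [] //=.
by split=> // a; rewrite /upd; case: (a == L + y); rewrite ?orbT ?orbF.
Qed.

Lemma match_mem u v w s : static s ->
    [/\ reg s rU = u, reg s rV = v & reg s rW = w] ->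
    [/\ reg s rA = mk u v, reg s rB = mk v w & reg s rC = mk u w] ->
  let x := wit (mem s) (mk u v) in
  let y := wit (mem s) (mk v w) in
  let go := is_p3 u v w &&
    [&& x != 0, y != 0, ~~ in_Z (mem s) x & ~~ in_Z (mem s) y] in
  (forall a, mem (den match_witnesses s) a =
     if go && ((a == L + x) || (a == L + y)) then 1 else mem s a) /\
  reg (den match_witnesses s) rFlag = if go then 1 else reg s rFlag.
Proof.
move=> st [sU sV sW] [sA sB sC] x y.
rewrite /match_witnesses; have := match_pair_mem; move: match_pair => p pE.
rewrite /is_p3 /= /upd /= sU sW sA sB sC.
rewrite addn_eq0 !subn_eq0 -eqn_leq -[mk u w == 0]negbK.
move: (mk u v != 0) (mk v w != 0) (mk u w != 0) (u == w) => [] [] [] [] //=.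
case: (st) => s0 s1 sN sL sLL.
set t := (X in den p X).
have tT : reg t rT = x by rewrite /t /= /upd /= sLL addnC.
have tY : reg t rY = y by rewrite /t /= /upd /= sLL addnC.
by have := pE t; rewrite tT tY; apply; split.
Qed.

Definition nonzero_wit f : pred nat := fun x => wit f x != 0.

Lemma imp_range u v w : u < n -> v < n -> w < n -> is_imp u v w ->
  (0 < mk u v <= m) && (0 < mk u w <= m).
Proof.
by move=> un vn wn /and3P [? ? _]; rewrite !lt0n !mk_le // !andbT; apply/andP.
Qed.

Lemma p3_range u v w : u < n -> v < n -> w < n -> is_p3 u v w ->
  (0 < mk u v <= m) && (0 < mk v w <= m).
Proof.
by move=> un vn wn /and4P [? ? _ _]; rewrite !lt0n !mk_le // !andbT; apply/andP.
Qed.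

Lemma wit_ok_ext f g : (forall a, f a = g a) -> wit_ok g -> wit_ok f.
Proof.
by move=> fg ok x xm; rewrite /wit /in_Z !fg; apply: ok.
Qed.

(** By the triangle, [mk u w] implies [mk u v], which implies its own witness; implication is
    transitive. *)
Lemma wit_ok_imp f g u v w : u < n -> v < n -> w < n -> is_imp u v w ->
  (forall a, g a = if a == L + L + mk u w then wit f (mk u v) else f a) ->
  wit f (mk u v) != 0 -> wit_ok f -> wit_ok g.
Proof.
move=> un vn wn I gE a0 ok; have /andP [am cm] := imp_range un vn wn I.
have gZ x : x <= m -> in_Z g x = in_Z f x.
  by move=> xm; rewrite /in_Z gE; case: ifP => // /eqP ?; lia.
have gW x : wit g x = if x == mk u w then wit f (mk u v) else wit f x.
  by rewrite /wit gE eqn_add2l.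
have okz x : 0 < x <= m -> wit f x != 0 ->
    [/\ 0 < wit f x <= m, ~~ in_Z g (wit f x)
      & forall S, feasible S -> S x -> S (wit f x)].
  move=> xm x0; have [/(_ x0) [w1 w2 w3] _] := ok x xm.
  by split=> //; rewrite gZ //; case/andP: w1.
move=> x xm; rewrite gW (gZ x); last by case/andP: xm.
case: ifP => [/eqP xc|_]; last first.
  by split; [apply: okz|case: (ok x xm)].
split=> // _; have [? ? HS] := okz _ am a0.
split=> // S fS Sx; apply: HS => //.
by have [_] := fS u v w un vn wn; apply; rewrite -?xc.
Qed.

(** Either some zero witness became nonzero, or no witness changed and every triangle was found
    closed. The negation in the first case ensures that a closed memory stays closed in later
    passes. *)
Lemma relax_pass s : static s -> input (mem s) -> wit_ok (mem s) ->
  let f := mem s in let g := mem (den (triples relax) s) in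
  [/\ forall a, a < L + L -> g a = f a, wit_ok g &
    cnt (nonzero_wit f) < cnt (nonzero_wit g) /\ ~ wit_closed f \/
    wit_closed f /\ wit_closed g].
Proof.
move=> st inp ok f g.
(* The record [X] is kept only while no witness has changed, so [Q] may speak of the initial memory
   [f]. *)
pose K (X : Prop) h (_ : nat) := [/\ forall a, a < L + L -> h a = f a, wit_ok h &
  cnt (nonzero_wit f) < cnt (nonzero_wit h) /\ ~ wit_closed f \/
  (forall x, 0 < x <= m -> wit h x = wit f x) /\ X].
pose Q u v w := is_imp u v w -> wit f (mk u v) != 0 -> wit f (mk u w) != 0.
have [] := @triples_scan K Q relax True s _ _ _ _ st _ => //.
- move=> X Y h e XY [? ? H]; split=> //.
  by case: H => [|[? /XY ?]]; [left|right].
- by move=> X h e [hf _ _]; apply: input_agree inp.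
- move=> u v w t Y un vn wn stt tU tA [hf okh Hh].
  have := relax_mem stt tU tA; set h := mem (den relax t) => E.
  have [/and3P [I /eqP c0 a0]|nofire] :=
      boolP [&& is_imp u v w, wit (mem t) (mk u w) == 0
              & wit (mem t) (mk u v) != 0].
    rewrite I c0 /= in E; have /andP [am cm] := imp_range un vn wn I.
    have lt : cnt (nonzero_wit (mem t)) < cnt (nonzero_wit h).
      apply: (@cnt_lt _ _ (mk u w)) => //; rewrite /nonzero_wit /wit.
      - by rewrite -/(wit _ _) c0.
      - by rewrite E eqxx.
      - by move=> x xm; rewrite E; case: ifP.
    split.
    + by move=> a aL; rewrite E hf //; case: eqP => // ?; lia.
    + exact: wit_ok_imp E a0 okh.
    left; case: Hh => [[lt' ncf]|[hW _]]; first by split=> //; apply: ltn_trans lt.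
    (* The witnesses before this step are still those of [f], so the present triangle shows that [f]
       was not closed. *)
    split; last first.
      by move/(_ _ _ _ un vn wn I); rewrite -!hW // c0 a0 => /(_ isT).
    rewrite (@eq_cnt _ (nonzero_wit (mem t))) // => x xm.
    by rewrite /nonzero_wit hW.
  have {}E a : h a = mem t a.
    rewrite E; case: ifP => // /andP [/andP [I c0] /eqP ->].
    by move: nofire; rewrite I c0 /= negbK => /eqP ->; rewrite -(eqP c0).
  split; first by move=> a aL; rewrite E hf.
    exact: wit_ok_ext okh.
  case: Hh => [[lt ncf]|[hW HY]]; [left|right]; split=> //.
  + apply: leq_trans lt _; rewrite (@eq_cnt _ (nonzero_wit h)) // => x _.
    by rewrite /nonzero_wit /wit E.
  + by move=> x xm; rewrite -hW // /wit E.
  split=> // I; have /andP [am cm] := imp_range un vn wn I.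
  move: nofire; rewrite I -!hW //=; case: (wit (mem t) (mk u w) == 0) => //=.
  by move/negPf ->.
- by split=> //; right.
move=> gf okg [?|[gw [_ C]]]; split=> //; [by left|right].
have cf : wit_closed f by move=> u v w un vn wn; apply: C.
split=> // u v w un vn wn I; have /andP [? ?] := imp_range un vn wn I.
by rewrite !gw //; apply: cf.
Qed.

(** A pass from a memory that is not closed gains a nonzero witness, which can happen at most
    [m < L] times. *)
Lemma relax_rounds s : static s -> input (mem s) -> wit_ok (mem s) ->
  let f := mem s in let g := mem (den (CFor rI rL (triples relax)) s) in
  [/\ forall a, a < L + L -> g a = f a, wit_ok g & wit_closed g].
Proof.
move=> st inp ok f g.
pose P k t := [/\ static t, forall a, a < L + L -> mem t a = f a,
  wit_ok (mem t) & wit_closed (mem t) \/ L - k <= cnt (nonzero_wit (mem t))].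
have sL : reg s rL = L by case: st.
suff [_ gf okg [|lt]] : P 0 (den (CFor rI rL (triples relax)) s).
- by split.
- by move: (leq_ltn_trans (leq_trans lt (cnt_le _)) m_lt); rewrite subn0 ltnn.
apply: for_ind; rewrite ?sL //; last by split=> //; right; rewrite subnn.
move=> k t kL _ [stt ft okt H].
have [ag okg] := relax_pass stt (input_agree ft inp) okt.
move=> R; split=> //; first exact: static_den.
  by move=> a aL; rewrite ag ?ft.
case: R => [[lt ncl]|[_ ?]]; [right|by left].
case: H => // le; apply: leq_trans lt; lia.
Qed.

(** * Growing the matching *)

Lemma matched_ext f g : (forall x, 0 < x <= m -> in_Z g x = in_Z f x) ->
  matched f -> matched g.
Proof.
move=> gf mf S fS; have := mf S fS; rewrite (@eq_cnt (in_Z f) (in_Z g)).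
  rewrite (@eq_cnt (predI (in_Z f) S) (predI (in_Z g) S)) //.
  by move=> x xm /=; rewrite gf.
by move=> x xm; rewrite gf.
Qed.

(* Every feasible set contains one of the two new elements [x] and [y], which
   pays for both of them. *)
Lemma matched_add f g x y : 0 < x <= m -> 0 < y <= m ->
  ~~ in_Z f x -> ~~ in_Z f y ->
  (forall z, 0 < z <= m -> in_Z g z = [|| z == x, z == y | in_Z f z]) ->
  (forall S, feasible S -> S x || S y) ->
  matched f -> matched g.
Proof.
move=> xm ym Zx Zy gE cov mf S fS.
have le2 : cnt (in_Z g) <= (cnt (in_Z f)).+2.
  have [xy|nxy] := eqVneq x y.
    apply: leqW; rewrite -(cnt_add1 xm Zx); apply: cnt_sub => z zm.
    by rewrite gE // -xy orbA orbb.
  have Zx' : ~~ [predU1 y & in_Z f] x by rewrite /= negb_or nxy.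
  rewrite -(cnt_add1 ym Zy) -(cnt_add1 xm Zx'); apply: cnt_sub => z zm.
  by rewrite gE.
have [z [zm Zz zg Sz]] : exists z, [/\ 0 < z <= m, ~~ in_Z f z, in_Z g z & S z].
  by case/orP: (cov S fS) => Sz; [exists x|exists y];
    split=> //; rewrite gE // eqxx ?orbT.
have : cnt (predI (in_Z f) S) < cnt (predI (in_Z g) S).
  apply: (@cnt_lt _ _ z) => //=; rewrite ?negb_and ?Zz ?zg //.
  by move=> z' zm' /andP [fz ->]; rewrite gE // fz !orbT.
by have := mf S fS; lia.
Qed.

(** Witnesses are not recomputed during the pass, so a match may put the witness of a later path
    into Z; hence membership in Z is tested again at each path. If the flag stays 0, then Z never
    changed and the initial witnesses settle every path. *)
Lemma match_pass s : static s -> input (mem s) -> wit_ok (mem s) ->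
  matched (mem s) -> reg s rFlag = 0 ->
  let f := mem s in
  let s' := den (triples match_witnesses) s in
  let g := mem s' in
  [/\ input g, matched g, forall x, 0 < x <= m -> wit g x = wit f x &
    reg s' rFlag != 0 /\ cnt (in_Z f) < cnt (in_Z g) \/
    [/\ reg s' rFlag = 0, forall x, 0 < x <= m -> in_Z g x = in_Z f x
      & wit_cover f]].
Proof.
move=> st inp ok mat fl f s' g.
pose K (X : Prop) h e := [/\ input h, matched h,
  forall x, 0 < x <= m -> wit h x = wit f x &
  e != 0 /\ cnt (in_Z f) < cnt (in_Z h) \/
  [/\ e = 0, forall x, 0 < x <= m -> in_Z h x = in_Z f x & X]].
pose Q u v w := is_p3 u v w -> wit f (mk u v) = 0 \/ wit f (mk v w) = 0.
have [] := @triples_scan K Q match_witnesses True s _ _ _ _ st _ => //.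
- move=> X Y h e XY [? ? ? H]; split=> //.
  by case: H => [|[? ? /XY ?]]; [left|right].
- by move=> X h e [].
- move=> u v w t Y un vn wn stt tU tA [inph mh hW H].
  have [] := match_mem stt tU tA.
  set h := mem (den match_witnesses t); set e := reg (den _ t) rFlag.
  set x := wit _ (mk u v); set y := wit _ (mk v w); set go := is_p3 u v w && _.
  move=> hE eE.
  case G: go; rewrite ?G in hE eE; last first.
    have {}hE a : h a = mem t a by rewrite hE.
    split.
    + by move=> u' v' un' vn'; rewrite hE inph.
    + by apply: matched_ext mh => z _; rewrite /in_Z hE.
    + by move=> z zm; rewrite /wit hE; apply: hW.
    rewrite eE; case: H => [[e1 lt]|[e0 hZ HY]]; [left|right]; split=> //.
    + apply: leq_trans lt _; rewrite (@eq_cnt _ (in_Z h)) // => z _.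
      by rewrite /in_Z hE.
    + by move=> z zm; rewrite -hZ // /in_Z hE.
    split=> // p3; have /andP [am bm] := p3_range un vn wn p3.
    have [x0|x0] := eqVneq x 0; first by left; rewrite -hW.
    have [y0|y0] := eqVneq y 0; first by right; rewrite -hW.
    (* While Z is unchanged, nonzero witnesses lie outside Z, so an unmatched path must have a zero
       witness. *)
    have Zok z : 0 < z <= m -> wit (mem t) z != 0 -> ~~ in_Z (mem t) (wit (mem t) z).
      move=> zm; rewrite hW // => z0; have [/(_ z0) [w1 w2 _] _] := ok z zm.
      by rewrite hZ.
    by move: G; rewrite /go p3 x0 y0 !Zok.
  case/and5P: G => p3 x0 y0 Zx Zy.
  have /andP [am bm] := p3_range un vn wn p3.
  have [|xm _ Sx] := (ok (mk u v) am).1; first by rewrite -hW.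
  have [|ym _ Sy] := (ok (mk v w) bm).1; first by rewrite -hW.
  rewrite -hW // -/x in xm Sx; rewrite -hW // -/y in ym Sy.
  have hZ z : 0 < z <= m -> in_Z h z = [|| z == x, z == y | in_Z (mem t) z].
    move=> zm; rewrite /in_Z hE !eqn_add2l /= orbA.
    by case: (_ || _).
  split.
  + move=> u' v' un' vn'; rewrite hE ifF ?inph //=.
    have := addr_le un' vn'; lia.
  + apply: (matched_add xm ym Zx Zy hZ) mh => S fS.
    have [/(_ p3) /orP [/(Sx _ fS) -> //|/(Sy _ fS) ->] _] := fS u v w un vn wn.
    by rewrite orbT.
  + move=> z zm; rewrite -hW // /wit hE ifF //=; lia.
  left; rewrite eE; split=> //.
  have lt : cnt (in_Z (mem t)) < cnt (in_Z h).
    apply: (@cnt_lt _ _ x) => //; first by rewrite hZ // eqxx.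
    by move=> z zm Zz; rewrite hZ // Zz !orbT.
  case: H => [[_ lt']|[_ hZ' _]]; first exact: ltn_trans lt.
  by rewrite (@eq_cnt _ (in_Z (mem t))) // => z zm; rewrite hZ'.
- by split=> //; right.
move=> ig mg gW H; split=> //.
case: H => [?|[e0 gZ [_ C]]]; [by left|right].
by split=> // u v w un vn wn; apply: C.
Qed.

(** * Iterating the rounds *)

Definition good f := [/\ wit_ok f, wit_closed f & wit_cover f].

Lemma good_ext f g : (forall x, 0 < x <= m -> wit g x = wit f x) ->
  (forall x, 0 < x <= m -> in_Z g x = in_Z f x) -> good f -> good g.
Proof.
move=> gW gZ [ok cl cov]; split.
- move=> x xm; rewrite gW // (gZ x) //; case: (ok x xm) => H1 H2; split=> // x0.
  by have [? ? ?] := H1 x0; split=> //; rewrite gZ.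
- move=> u v w un vn wn I; have /andP [am cm] := imp_range un vn wn I.
  by rewrite !gW //; apply: cl.
move=> u v w un vn wn p3; have /andP [am bm] := p3_range un vn wn p3.
by rewrite !gW //; apply: cov.
Qed.

Lemma round_spec s : static s -> input (mem s) -> matched (mem s) ->
  let s' := den round s in
  [/\ static s', input (mem s'), matched (mem s') &
    reg s' rFlag != 0 /\ cnt (in_Z (mem s)) < cnt (in_Z (mem s')) \/
    reg s' rFlag = 0 /\ good (mem s')].
Proof.
move=> st inp mat s'; rewrite /s' /round 3!den_seq.
set s0 := den (CConst rFlag 0) s.
have [st1 ag1 W1] := @reset_spec s0 st.
set s1 := den reset s0 in st1 ag1 W1 *.
have [ag2 ok2 cl2] :=
  relax_rounds st1 (input_agree ag1 inp) (wit_ok_reset ag1 W1).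
set s2 := den (CFor _ _ _) s1 in ag2 ok2 cl2 *.
have {ag1 W1}ag a : a < L + L -> mem s2 a = mem s a.
  by move=> aL; rewrite ag2 // ag1.
have st2 : static s2 by apply: static_den.
have Z2 x : 0 < x <= m -> in_Z (mem s2) x = in_Z (mem s) x.
  by case/andP=> _ xm; apply: in_Z_agree.
have fl2 : reg s2 rFlag = 0 by rewrite /s2 den_frame // /s1 den_frame.
have := match_pass st2 (input_agree ag inp) ok2 (matched_ext Z2 mat) fl2.
case=> inp3 mat3 W3 H; split=> //; first exact: static_den.
case: H => [[? lt]|[? Z3 cov]]; [left|right]; split=> //.
  by rewrite (@eq_cnt _ (in_Z (mem s2))) // => x xm; rewrite Z2.
by apply: (good_ext W3 Z3); split.
Qed.

(** Each round that ends with the flag set has enlarged Z, which contains at most [m < L] marks;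
    hence the flag is 0 after L rounds. *)
Lemma rounds_spec s : static s -> input (mem s) -> matched (mem s) ->
    reg s rFlag = 1 ->
  let s' := den (CFor rK rL (CIf rFlag round CSkip)) s in
  [/\ static s', matched (mem s') & good (mem s')].
Proof.
move=> st inp mat fl s'; have sL : reg s rL = L by case: st.
pose P k t := [/\ static t, input (mem t), matched (mem t) &
  reg t rFlag != 0 /\ L - k <= cnt (in_Z (mem t)) \/
  reg t rFlag = 0 /\ good (mem t)].
suff: P 0 s'.
  case=> st' _ mat' [[_ lt]|[_ ?]]; split=> //.
  by move: (leq_ltn_trans (leq_trans lt (cnt_le _)) m_lt); rewrite subn0 ltnn.
have nK : rK \notin writes (CIf rFlag round CSkip) by [].
apply: for_ind; rewrite ?sL //; last first.
- by split=> //; left; rewrite fl subnn.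
move=> k t kL _ [stt inpt matt H].
rewrite den_if.
case: ifP => [e|e]; last first.
  by split=> //; case: H => [[e1]|[]]; [rewrite e1 in e|right].
have [st' inp' mat' H'] := round_spec stt inpt matt.
split=> //; case: H' => [[e' lt]|]; last by right.
case: H => [[_ le]|[e0]]; last by rewrite e0 in e.
left; split=> //; apply: leq_trans lt; lia.
Qed.

(** * Output of the solution and number of hedges *)

Lemma write_output_spec s : static s -> reg s rM = m ->
  let g := mem (den write_output s) in
  g 0 = m /\ forall x, 0 < x <= m -> g x = (wit (mem s) x == 0).
Proof.
move=> st sM g; have sL : reg s rL = L by case: st.
pose P k t := [/\ static t, reg t rM = m,
  forall a, L <= a -> mem t a = mem s a
  & forall x, k <= x < L -> mem t x = (wit (mem s) x == 0)].
rewrite /g /write_output den_seq.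
set p := CFor _ _ _; suff: P 0 (den p s).
  move: (den p s) => t [[t0 _ _ _ _] tM _ H] /=; rewrite /upd t0 tM.
  split=> // x /andP [x0 xm]; rewrite gtn_eqF // H //.
  exact: leq_ltn_trans xm m_lt.
apply: for_ind; rewrite ?sL //; last first.
- by split=> // x; case: leqP.
move=> k t kL tX [stt tM hi lo].
case: (stt) => _ _ _ _ tLL.
set body := (_ ;; _)%cmd.
have E a : mem (den body t) a =
    if a == k then nat_of_bool (wit (mem s) k == 0) else mem t a.
  rewrite /= /upd /= tX tLL (addnC k) hi; last by lia.
  rewrite -/(wit (mem s) k); case: (wit (mem s) k == 0) => /=;
  by rewrite /upd /= tX.
split.
- exact: static_den.
- by rewrite den_frame.
- by move=> a aL; rewrite E ifF ?hi //; lia.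
move=> x /andP [kx xL]; rewrite E; case: ifP => [/eqP -> //|nx].
apply: lo; lia.
Qed.

Lemma max_mark_spec s : static s -> input (mem s) -> reg s rM = 0 ->
  reg (den max_mark s) rM = m.
Proof.
move=> st inp sM.
have sN t : static t -> reg t rN = n by case.
pose P k t := [/\ static t, mem t = mem s, reg t rM <= m &
  forall u v, k <= u < n -> v < n -> mk u v <= reg t rM].
suff: P 0 (den max_mark s).
  case=> _ _ le ge; apply/eqP; rewrite eqn_leq le /=.
  have [->//|/mk_max [u [v [un vn <-]]]] := posnP m.
  exact: ge.
apply: for_ind; rewrite ?sN //; last first.
- by split=> //; rewrite ?sM // => u v; case: leqP.
move=> k t kn tU [stt tm tM H].
pose P' l t := [/\ static t /\ mem t = mem s, reg t rU = k, reg t rM <= m,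
  forall u v, k < u < n -> v < n -> mk u v <= reg t rM &
  forall v, l <= v < n -> mk k v <= reg t rM].
set p := CFor _ _ _; suff: P' 0 (den p t).
  case=> [[? ?] ? ? H1 H2]; split=> // u v /andP [].
  rewrite leq_eqVlt => /orP [/eqP <- _ vn|ku un vn]; first exact: H2.
  by apply: H1; rewrite // ku.
apply: for_ind; rewrite ?sN //; last first.
- by split=> // v; case: leqP.
move=> l t1 ln t1V [[st1 m1] t1U t1M H1 H2].
rewrite den_seq; set t2 := den (get_mark _ _ _) t1.
have st2 : static t2 by apply: static_den.
have m2 : mem t2 = mem s by rewrite -m1; apply: den_no_store.
have t2U : reg t2 rU = k by rewrite -t1U /t2 den_frame.
have t2M : reg t2 rM = reg t1 rM by rewrite /t2 den_frame.
have t2A : reg t2 rA = mk k l.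
  by rewrite /t2 get_mark_reg ?m1 ?t1U ?t1V.
clearbody t2; set q := (_ ;; _)%cmd.
have qM : reg (den q t2) rM = maxn (reg t1 rM) (mk k l).
  case: (st2) => t20 _ _ _ _.
  rewrite /= /upd /= t2A t2M; case: ifP => /= lt; rewrite /upd /= ?t2A ?t20 ?t2M; lia.
split.
- by split; [apply: static_den|rewrite den_no_store].
- by rewrite den_frame.
- by rewrite qM geq_max t1M mk_le.
- by move=> u v ku vn; rewrite qM leq_max H1.
move=> v /andP []; rewrite qM leq_max leq_eqVlt => /orP [/eqP <- _|lv vn].
  by rewrite leqnn orbT.
by rewrite H2 ?lv.
Qed.

(** * The complete program *)

Lemma main_spec s : static s -> input (mem s) ->
    (forall x, L < x -> mem s x = 0) -> reg s rM = 0 ->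
  exists F : pred nat, [/\ mem (den main s) 0 = m,
    forall x, 0 < x <= m -> mem (den main s) x = F x,
    feasible F & forall S, feasible S -> cnt F <= 2 * cnt S].
Proof.
move=> st inp z sM; rewrite /main 3!den_seq.
have s1M := max_mark_spec st inp sM.
have m1 : mem (den max_mark s) = mem s by apply: den_no_store.
have st1 : static (den max_mark s) by apply: static_den.
set s1 := den max_mark s in s1M m1 st1 *; clearbody s1.
set s2 := den (CConst _ _) s1.
(* Z starts empty, since the cells beyond the input hold 0. *)
have mat2 : matched (mem s2).
  move=> S fS; rewrite (@eq_cnt _ pred0) ?/cnt ?count_pred0 //.
  by move=> x /andP [x0 _]; rewrite /in_Z /= m1 z //; lia.
have inp2 : input (mem s2) by rewrite /= m1.
have [st3 mat3 [ok cl cov]] := @rounds_spec s2 st1 inp2 mat2 erefl.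
have s3M : reg (den (CFor rK rL (CIf rFlag round CSkip)) s2) rM = m.
  by rewrite den_frame.
set s3 := den (CFor _ _ _) s2 in st3 mat3 ok cl cov s3M *; clearbody s3.
have [o0 o1] := write_output_spec st3 s3M.
(* The hedges without a witness are deleted: [cov] gives the path clauses, [cl] the triangle clauses
   by contraposition, and [ok] the inclusion in Z. *)
exists (fun x => wit (mem s3) x == 0); split=> //.
- move=> u v w un vn wn; split=> [p3|I].
    by have [->|->] := cov u v w un vn wn p3; rewrite ?eqxx ?orbT.
  by apply: contraLR; apply: cl.
move=> S fS; apply: (@leq_trans (cnt (in_Z (mem s3)))).
  by apply: cnt_sub => x xm; apply: contraLR => /(ok x xm).2.
apply: leq_trans (mat3 S fS) _; rewrite leq_mul2l /=.
by apply: cnt_sub => x _ /andP [].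
Qed.

(** Registers are initially 0, so [r0] needs no assignment. Cell 0 holds the length of the encoding,
    which is L, and cell 1 holds n. *)
Definition setup : prog :=
  Seq (Const r1 1) (Seq (Read rL r0) (Seq (Read rN r1) (Add rLL rL rL))).

Definition hcd_prog : prog := Seq setup (compile main).

Lemma hcd_prog_spec x : size x = L -> nth 0 x 0 = n ->
    (forall u v, u < n -> v < n -> nth 0 x (1 + u * n + v) = mk u v) ->
  exists t s, exists F : pred nat,
  [/\ exec hcd_prog (init_state x) t s,
      t <= cost_coef main * L ^ cost_deg main + 4,
      output s = [seq nat_of_bool (F i) | i <- iota 1 m],
      feasible F
    & forall S, feasible S -> cnt F <= 2 * cnt S].
Proof.
move=> xL x0 xE.
pose s1 := set_reg (init_state x) r1 1.
pose s2 := set_reg s1 rL (mem s1 (reg s1 r0)).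
pose s3 := set_reg s2 rN (mem s2 (reg s2 r1)).
pose s4 := set_reg s3 rLL (reg s3 rL + reg s3 rL).
have st : static s4 by split; rewrite /= /upd /= ?x0 ?xL.
have mem4 : mem s4 = mem (init_state x) by [].
have inp : input (mem s4) by move=> u v un vn; rewrite -xE // mem4 /= add1n.
have z a : L < a -> mem s4 a = 0.
  by move=> aL; apply: (@nth_default _ 0 (size x :: x)); rewrite /= xL.
have [F [o0 o1 fF optF]] := main_spec st inp z erefl.
have [|||||||t [et lt]] := @exec_den L main s4 => //; try by case: st.
- by case: st => _ _ -> _ _; rewrite L_def; nia.
- by case: st => _ _ _ -> _.
- by rewrite L_def.
set s' := den main s4 in o0 o1 et *; clearbody s'.
exists (1 + (1 + (1 + 1)) + t), s', F; split=> //.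
- apply: ESeq et; apply: ESeq; first by constructor.
  by apply: ESeq; [constructor|apply: ESeq; constructor].
- lia.
rewrite /output o0 (iotaDl 1 0) -map_comp.
by apply/eq_in_map => i; rewrite mem_iota => /andP [_ im]; apply: o1.
Qed.

End Correctness.

(** * Hedge graphs and their encodings *)

(** In the absence of induced paths on three vertices, a walk between distinct vertices shrinks to
    an edge, one vertex at a time. *)
Lemma cluster_graphP (V : finType) (e : rel V) : symmetric e ->
  cluster_graph e <-> forall u v w, e u v -> e v w -> u != w -> e u w.
Proof.
move=> esym; split=> [cg u v w uv vw uw|tr x y z].
  apply: (cg u) => //; rewrite inE ?connect0 //.
  exact: connect_trans (connect1 uv) (connect1 vw).
rewrite !inE => xy xz; have: connect e y z.
  by rewrite (connect_trans _ xz) // (sym_connect_sym esym).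
case/connectP=> p; elim: p y {xy} => [|v p IHp] y /=; first by move=> _ ->; rewrite eqxx.
case/andP=> yv vp zE yz; have [vz|vz] := eqVneq v z; first by rewrite -vz.
by apply: (tr y v z) => //; apply: IHp.
Qed.

Lemma nth_allpairs (T1 T2 : Type) (T3 : Type) (f : T1 -> T2 -> T3) s t x1 x2 x3 i j :
  i < size s -> j < size t ->
  nth x3 [seq f x y | x <- s, y <- t] (i * size t + j) =
    f (nth x1 s i) (nth x2 t j).
Proof.
elim: s i => // x s IHs [|i] /= lti ltj; rewrite nth_cat size_map.
  by rewrite mul0n add0n ltj (nth_map x2).
by rewrite mulSn -addnA ltnNge leq_addr /= addKn IHs.
Qed.

Lemma map_index_iota (T : eqType) (s : seq T) : uniq s ->
  [seq (index x s).+1 | x <- s] = iota 1 (size s).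
Proof.
case: s => // x0 s0; set s := x0 :: s0 => us.
apply: (@eq_from_nth _ 0) => [|i]; rewrite size_map ?size_iota // => lti.
by rewrite (nth_map x0) // nth_iota // index_uniq.
Qed.

Section Encoding.

Variables (G : hedge_graph) (hs : seq {set {set 'I_(nverts G)}}).
Hypothesis hsE : perm_eq hs (enum (hedges G)).

Local Notation n := (nverts G).

(** The offset 1 skips n at the head of the list; in memory it becomes 2, because the length
    precedes the list. *)
Definition mark (a b : nat) := nth 0 (encode_graph hs) (1 + a * n + b).

Lemma mem_hs h : (h \in hs) = (h \in hedges G).
Proof. by rewrite (perm_mem hsE) mem_enum. Qed.

Lemma uniq_hs : uniq hs.
Proof. by rewrite (perm_uniq hsE) enum_uniq. Qed.

Lemma size_encode : size (encode_graph hs) = (n * n).+1.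
Proof. by rewrite /= size_allpairs !size_enum_ord. Qed.

Lemma markE (u v : 'I_n) : mark u v = hedge_mark hs u v.
Proof.
have [un vn] := (ltn_ord u, ltn_ord v); rewrite /mark -addnA add1n /=.
have -> : u * n = u * size (enum 'I_n) by rewrite size_enum_ord.
by rewrite (nth_allpairs _ u u) ?size_enum_ord // !nth_ord_enum.
Qed.

Lemma mem_edge_set (u v : 'I_n) : adj u v -> [set u; v] \in cover (hedges G).
Proof.
move=> uv; rewrite (cover_partition (hedgesP G)).
by apply/imsetP; exists (u, v); rewrite ?inE.
Qed.

Lemma hedge_ofP (u v : 'I_n) : adj u v -> hedge_of u v \in hedges G.
Proof. by move=> uv; rewrite pblock_mem // mem_edge_set. Qed.

Lemma hedge_edge h : h \in hedges G ->
  exists u v : 'I_n, adj u v /\ hedge_of u v = h.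
Proof.
move=> hG; have /and3P [_ tr h0] := hedgesP G.
have /set0Pn [e eh] : h != set0 by apply: contraNneq h0 => <-.
have: e \in cover (hedges G) by apply/bigcupP; exists h.
rewrite (cover_partition (hedgesP G)) => /imsetP [[u v] /=].
rewrite inE /= => uv eE; exists u, v; split=> //.
by apply: def_pblock => //; rewrite -eE.
Qed.

Lemma mark_neq0 (u v : 'I_n) : (mark u v != 0) = adj u v.
Proof. by rewrite markE /hedge_mark; case: adj. Qed.

Lemma mark_le u v : u < n -> v < n -> mark u v <= size hs.
Proof.
move=> un vn; rewrite -[u]/(val (Ordinal un)) -[v]/(val (Ordinal vn)) markE.
by rewrite /hedge_mark; case: ifP => // uv; rewrite index_mem mem_hs hedge_ofP.
Qed.

(** Blocks of a partition are nonempty, so the last hedge of [hs] has an edge. *)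
Lemma mark_max : 0 < size hs ->
  exists u v, [/\ u < n, v < n & mark u v = size hs].
Proof.
move=> m0; have hG : nth set0 hs (size hs).-1 \in hedges G.
  by rewrite -mem_hs mem_nth // prednK.
have [u [v [uv hE]]] := hedge_edge hG; exists u, v.
by rewrite markE /hedge_mark uv hE index_uniq ?uniq_hs ?prednK.
Qed.

(** Every hedge is the hedge of some pair of vertices, and there are n * n pairs. *)
Lemma size_hs : size hs < (n * n).+1.
Proof.
rewrite (perm_size hsE) -cardE ltnS.
pose f (p : 'I_n * 'I_n) := hedge_of p.1 p.2.
have sub : hedges G \subset f @: setT.
  apply/subsetP => h /hedge_edge [u [v [_ <-]]].
  by apply/imsetP; exists (u, v); rewrite ?inE.
apply: leq_trans (subset_leq_card sub) (leq_trans (leq_imset_card _ _) _).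
by rewrite cardsT card_prod card_ord.
Qed.

(** * Solutions as feasible sets of marks *)

Lemma delete_hedgesE (F : {set {set {set 'I_n}}}) u v : F \subset hedges G ->
  delete_hedges F u v = adj u v && (hedge_of u v \notin F).
Proof.
move=> FG; rewrite /delete_hedges /=; have [uv|//] := boolP (adj u v).
rewrite /=; congr (~~ _).
have /and3P [_ tr _] := hedgesP G; have uvc := mem_edge_set uv.
apply/bigcupP/idP => [[h hF uvh]|hF].
  by rewrite /hedge_of (def_pblock tr (subsetP FG _ hF) uvh).
by exists (hedge_of u v); rewrite // mem_pblock.
Qed.

Lemma delete_hedges_sym (F : {set {set {set 'I_n}}}) :
  symmetric (delete_hedges F).
Proof. by move=> u v; rewrite /delete_hedges /= adj_sym setUC. Qed.

Lemma cnt_hs (P : pred nat) (F : {set {set {set 'I_n}}}) :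
    F \subset hedges G -> {in hs, forall h, P (index h hs).+1 = (h \in F)} ->
  cnt (size hs) P = #|F|.
Proof.
move=> FG PF; rewrite /cnt -(map_index_iota uniq_hs) count_map.
rewrite (eq_in_count (a2 := [in F])) // (permP hsE) cardE.
rewrite -size_filter /enum_mem; apply: perm_size; apply: uniq_perm.
- by rewrite filter_uniq ?enum_uniq.
- exact: enum_uniq.
move=> h; rewrite mem_filter !mem_enum.
by case: (boolP (h \in F)) => // /(subsetP FG).
Qed.

(** Kept edges uv and vw require a kept edge uw. If uw is not an edge, one of the two hedges must be
    deleted; if uv and vw share a hedge, keeping it forces keeping the hedge of uw. *)
Lemma feasible_solution (F : {set {set {set 'I_n}}}) : hcd_solution F ->
  feasible n mark (fun x => nth set0 hs x.-1 \in F).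
Proof.
move=> [FG /(cluster_graphP (delete_hedges_sym F)) tr] u v w un vn wn.
rewrite -[u]/(val (Ordinal un)) -[v]/(val (Ordinal vn)) -[w]/(val (Ordinal wn)).
move: (Ordinal un) (Ordinal vn) (Ordinal wn) => {u v w un vn wn} u v w.
(* Marks of edges lie between 1 and [size hs], so the predecessor is exact and the default [set0] is
   not reached. *)
have SE x y : adj x y -> nth set0 hs (mark x y).-1 = hedge_of x y.
  by move=> xy; rewrite markE /hedge_mark xy nth_index // mem_hs hedge_ofP.
have {}tr : adj u v -> adj v w -> u != w -> hedge_of u v \notin F ->
    hedge_of v w \notin F -> adj u w && (hedge_of u w \notin F).
  move=> uv vw uw Fu Fv; rewrite -delete_hedgesE //.
  by apply: (tr u v w) => //; rewrite delete_hedgesE ?uv ?vw.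
rewrite /is_p3 /is_imp !mark_neq0 -[mark u w == 0]negbK mark_neq0; split.
  case/and4P=> uv vw uw nuw; rewrite !SE //.
  by apply: contraR uw; rewrite negb_or => /andP [Fu Fv]; case/andP: (tr uv vw nuw Fu Fv).
case/and3P=> uv uw /eqP eq_m; have vw : adj v w by rewrite -mark_neq0 -eq_m mark_neq0.
rewrite !SE //; apply: contraLR => Fu.
have nuw : u != w by apply: contraTneq uw => ->; rewrite adj_irr.
have Fv : hedge_of v w \notin F by rewrite -SE // -eq_m SE.
by case/andP: (tr uv vw nuw Fu Fv).
Qed.

(** If uv and vw are kept and the edge uw is deleted, the hedge of uw differs from the other two.
    These either coincide, against the triangle clause, or give the triangle three distinct hedges,
    against the bi-hedge property. *)
Lemma solution_feasible (P : pred nat) : bi_hedge G ->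
  feasible n mark P -> hcd_solution [set h in hedges G | P (index h hs).+1].
Proof.
move=> biG fP; set F := [set h in _ | _].
have FG : F \subset hedges G by apply/subsetP => h; rewrite inE => /andP [].
split=> //; apply/(cluster_graphP (delete_hedges_sym F)) => u v w.
have FE x y : adj x y -> (hedge_of x y \in F) = P (mark x y).
  by move=> xy; rewrite inE hedge_ofP // markE /hedge_mark xy.
rewrite !delete_hedgesE // => /andP [uv Fuv] /andP [vw Fvw] nuw.
have [p3 imp] := fP u v w (ltn_ord u) (ltn_ord v) (ltn_ord w).
move: p3 imp; rewrite /is_p3 /is_imp -[mark u w == 0]negbK !mark_neq0 uv vw nuw andbT /=.
rewrite -(FE u v) // -(FE v w) // (negPf Fuv) (negPf Fvw) /=.
have [uw _ imp|_ /(_ isT)] := boolP (adj u w); last by [].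
apply/negP => Fuw; move: imp; rewrite -FE // Fuw /=.
have nuvuw : hedge_of u v != hedge_of u w by apply: contraNneq Fuv => ->.
have nvwuw : hedge_of v w != hedge_of u w by apply: contraNneq Fvw => ->.
have [e|ne] := eqVneq (hedge_of u v) (hedge_of v w).
  by rewrite !markE /hedge_mark uv vw e eqxx => /(_ isT isT).
have := biG u v w uv vw uw.
by rewrite setUC cardsU1 cards2 !inE eq_sym (negPf nuvuw) eq_sym (negPf nvwuw) ne.
Qed.

End Encoding.

Theorem theorem5p6 : exists p : prog, hcd_poly_time_approx 2 bi_hedge p.
Proof.
(* The same number is the factor and the summand of the time bound; its 4 pays for the setup. *)
exists hcd_prog, (cost_coef main + 4), (cost_deg main) => G hs biG hsE.
have [t [s [P [et lt outE fP optP]]]] :=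
  hcd_prog_spec erefl (size_hs hsE) (mark_le hsE) (mark_max hsE)
    (size_encode hs) erefl (fun _ _ _ _ => erefl).
set F := [set h in hedges G | P (index h hs).+1].
have FE : {in hs, forall h, P (index h hs).+1 = (h \in F)}.
  by move=> h; rewrite (mem_hs hsE) inE => ->.
have FG : F \subset hedges G by apply/subsetP => h; rewrite inE => /andP [].
exists t, s, F; split=> //.
- by rewrite size_encode; nia.
- rewrite outE /encode_hedges -(map_index_iota (uniq_hs hsE)) -map_comp.
  by apply/eq_in_map => h /FE /= ->.
split=> [|F' solF']; first exact: solution_feasible.
have := optP _ (feasible_solution hsE solF').
rewrite (cnt_hs hsE FG FE) (cnt_hs hsE solF'.1) // => h hh.
by rewrite nth_index.
Qed.
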